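(* Let $G$ be a connected twin-free graph with $\gamma^{\rm ID}(G)=4$. Then $\gamma^{\rm ID}(G \Box K_2) =\gamma^{\rm ID}(G)$ if and only if $G \in \mathcal{A}\bowtie K_1$, where the class $\mathcal{A}\bowtie K_1$ is defined in the context.
   Context: All graphs are finite, simple and undirected, considered up to isomorphism. $N[x]$ denotes the closed neighborhood of $x$; a graph is twin-free if no two distinct vertices have the same closed neighborhood. An identifying code (ID code) of a graph $F$ is a set $C\subseteq V(F)$ such that $N[x]\cap C\neq\emptyset$ for every vertex $x$ and $N[x]\cap C\neq N[y]\cap C$ for all distinct vertices $x,y$; $\gamma^{\rm ID}(F)$ is the minimum cardinality of an ID code of $F$. $\Box$ denotes the Cartesian product of graphs. The join $F_1\bowtie F_2$ is the disjoint union of $F_1$ and $F_2$ together with all edges between $V(F_1)$ and $V(F_2)$. For an integer $k\ge 1$, $A_k$ is the graph with vertex set $\{x_1,\dots,x_{2k}\}$ in which distinct $x_i,x_j$ are adjacent if and only if $|i-j|\le k-1$ (so $A_1=\overline{K_2}$ and $A_2=P_4$). $\mathcal{A}$ is the closure of $\{A_k : k\ge 1\}$ under $\bowtie$, i.e. the class of all graphs $A_{k_1}\bowtie\cdots\bowtie A_{k_r}$ with $r\ge 1$ and all $k_i\ge 1$. $\mathcal{A}\bowtie K_1=\{F\bowtie K_1 : F\in\mathcal{A}\}$. *)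

(* Defs.v *)
From mathcomp Require Import all_boot.
Set Implicit Arguments.
Unset Strict Implicit.
Unset Printing Implicit Defensive.

(* MathComp; arithmetic is on nat. *)

Record sgraph := SGraph {
  vertex :> finType;
  adj : rel vertex;
  adj_sym : symmetric adj;
  adj_irrefl : irreflexive adj }.

Definition isomorphic (G H : sgraph) : Prop :=
  exists2 f : G -> H, bijective f & {mono f : x y / adj x y}.

(* The graph without vertices is not counted as connected. *)
Definition connected (G : sgraph) : Prop :=
  0 < #|G| /\ forall x y : G, connect (@adj G) x y.

Definition closed_nbhd (G : sgraph) (x : G) : {set G} :=
  [set y | (y == x) || adj x y].

Definition twin_free (G : sgraph) : Prop := injective (@closed_nbhd G).

Definition id_code (G : sgraph) (C : {set G}) : bool :=
  [forall x, closed_nbhd x :&: C != set0]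
  && [forall x, forall y,
        (x != y) ==> (closed_nbhd x :&: C != closed_nbhd y :&: C)].

(* A graph with twins has no identifying code; the minimum then takes the
   irrelevant value #|G|. The two lemmas below cover the twin-free case. *)
Definition gammaID (G : sgraph) : nat :=
  #|[arg min_(C < [set: G] | id_code C) #|C|]|.

Lemma id_code_setT (G : sgraph) : twin_free G -> id_code [set: G].
Proof.
move=> tfG; apply/andP; split; apply/forallP => x.
  by apply/set0Pn; exists x; rewrite !inE eqxx.
by apply/forallP => y; apply/implyP; rewrite !setIT; apply/contra_neq/tfG.
Qed.

Lemma gammaIDP (G : sgraph) (n : nat) : twin_free G ->
  gammaID G = n <->
  (exists2 C : {set G}, id_code C & #|C| = n)
  /\ (forall C : {set G}, id_code C -> n <= #|C|).
Proof.
move=> tfG; rewrite /gammaID; case: arg_minnP => [|C codeC minC].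
  exact: id_code_setT.
split=> [<- | [[D codeD <-] minD]]; first by split; first by exists C.
by apply/eqP; rewrite eqn_leq minC ?minD.
Qed.

Definition complete_rel n : rel 'I_n := fun i j => i != j.

Lemma complete_sym n : symmetric (@complete_rel n).
Proof. by move=> i j; rewrite /complete_rel eq_sym. Qed.

Lemma complete_irrefl n : irreflexive (@complete_rel n).
Proof. by move=> i; rewrite /complete_rel eqxx. Qed.

Definition complete_graph n := SGraph (@complete_sym n) (@complete_irrefl n).

Section Operations.
Variables G H : sgraph.

Definition box_rel : rel (G * H) := fun u v =>
  ((u.1 == v.1) && adj u.2 v.2) || ((u.2 == v.2) && adj u.1 v.1).

Lemma box_sym : symmetric box_rel.
Proof.
move=> u v; rewrite /box_rel [u.1 == _]eq_sym [u.2 == _]eq_sym.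
by rewrite [adj u.1 _]adj_sym [adj u.2 _]adj_sym.
Qed.

Lemma box_irrefl : irreflexive box_rel.
Proof. by move=> u; rewrite /box_rel !adj_irrefl !andbF. Qed.

Definition box : sgraph := SGraph box_sym box_irrefl.

Definition join_rel : rel (G + H) := fun u v =>
  match u, v with
  | inl x, inl y => adj x y
  | inr x, inr y => adj x y
  | _, _ => true
  end.

Lemma join_sym : symmetric join_rel.
Proof. by move=> [x|x] [y|y] //=; exact: adj_sym. Qed.

Lemma join_irrefl : irreflexive join_rel.
Proof. by move=> [x|x] /=; exact: adj_irrefl. Qed.

Definition join : sgraph := SGraph join_sym join_irrefl.

End Operations.

(* The ordinal i stands for x_(i+1). Since subtraction on nat is truncated,
   (i - j) + (j - i) is |i - j|. *)
Definition A_rel k : rel 'I_(2 * k) := fun i j =>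
  (i != j) && ((i - j) + (j - i) <= k.-1).

Lemma A_sym k : symmetric (@A_rel k).
Proof. by move=> i j; rewrite /A_rel eq_sym addnC. Qed.

Lemma A_irrefl k : irreflexive (@A_rel k).
Proof. by move=> i; rewrite /A_rel eqxx. Qed.

Definition A_graph k := SGraph (@A_sym k) (@A_irrefl k).

(* Concrete representatives of the isomorphism classes: isomorphism is only
   taken into account in A_join_K1, which suffices because join respects it. *)
Inductive class_A : sgraph -> Prop :=
| class_A_base k : 0 < k -> class_A (A_graph k)
| class_A_join F1 F2 : class_A F1 -> class_A F2 -> class_A (join F1 F2).

Definition A_join_K1 (G : sgraph) : Prop :=
  exists2 F, class_A F & isomorphic G (join F (complete_graph 1)).

(* Main.v *)
Require Import Defs.
From mathcomp Require Import all_boot zify.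
Set Implicit Arguments.
Unset Strict Implicit.
Unset Printing Implicit Defensive.

(* Let n = |G|.  A code of size 4 in G x K2 splits between the two layers, one
   of which carries a part of size k <= 2.  The n - (4 - k) vertices outside the
   other part are told apart in that layer by the part of size k alone, so that
   n - (4 - k) < 2^k and n <= 5.  The graphs on at most 5 vertices are then
   inspected by computation (n >= 4 is clear): only the fan P4 >< K1 and the wheel C4 >< K1
   remain.  Conversely, in F >< K1 with F in the class A, every vertex v of F is
   the only vertex telling some pair apart, so a code contains F; hence |F| = 4,
   and F is A_2 = P4 or A_1 >< A_1 = C4. *)

(** * Closed adjacency and separation by codes *)

Definition nbr (G : sgraph) : rel G := fun x y => (y == x) || adj x y.

Lemma nbr_sym (G : sgraph) : symmetric (@nbr G).
Proof. by move=> x y; rewrite /nbr eq_sym adj_sym. Qed.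

Lemma in_closed_nbhd (G : sgraph) (x y : G) : (y \in closed_nbhd x) = nbr x y.
Proof. by rewrite inE. Qed.

Lemma id_codeP (G : sgraph) (C : {set G}) :
  reflect ((forall x, exists2 z, z \in C & nbr x z)
           /\ forall x y, x != y -> exists2 z, z \in C & nbr x z != nbr y z)
          (id_code C).
Proof.
apply: (iffP andP) => -[dom sep]; split.
- move=> x; have /set0Pn[z] := forallP dom x.
  by rewrite inE in_closed_nbhd => /andP[xz zC]; exists z.
- move=> x y xy; have /forallP/(_ y)/implyP/(_ xy) := forallP sep x.
  move=> neq; apply/exists_inP; apply: contraNT neq => /exists_inPn eqC.
  apply/eqP/setP => z; rewrite !inE -!/(nbr _ _).
  by case zC: (z \in C); rewrite ?andbF // !andbT; apply/eqP/negPn/eqC.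
- apply/forallP => x; have [z zC xz] := dom x.
  by apply/set0Pn; exists z; rewrite inE in_closed_nbhd xz.
- apply/forallP => x; apply/forallP => y; apply/implyP => /sep[z zC].
  by apply: contraNneq => /setP/(_ z); rewrite !inE zC !andbT /nbr => ->.
Qed.

Lemma id_code_twin_free (G : sgraph) (C : {set G}) : id_code C -> twin_free G.
Proof.
move=> /id_codeP[_ sep] x y Nxy; apply/eqP; apply: contraT => /sep[z _].
by rewrite -!in_closed_nbhd Nxy eqxx.
Qed.

(** The values [f x] are distinct nonempty subsets of [C]. Restricting to [X] serves the prism,
    where only the vertices outside one layer are counted. *)
Lemma card_lt_exp2 (T U : finType) (X : {set T}) (C : {set U})
    (f : T -> {set U}) :
  {in X &, injective f} -> (forall x, x \in X -> f x \subset C) ->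
  (forall x, x \in X -> f x != set0) -> #|X| < 2 ^ #|C|.
Proof.
move=> injf subf nzf; rewrite -card_powerset (cardsD1 set0) inE sub0set ltnS.
rewrite -(card_in_imset injf); apply/subset_leq_card/subsetP => _ /imsetP[x xX ->].
by rewrite !inE nzf ?subf.
Qed.

Lemma id_code_card_lt (G : sgraph) (C : {set G}) : id_code C -> #|G| < 2 ^ #|C|.
Proof.
move=> /andP[/forallP dom /forallP sep]; rewrite -cardsT.
apply: (@card_lt_exp2 _ _ _ _ (fun x => closed_nbhd x :&: C)) => [x y _ _ Nxy|x _|x _].
- apply/eqP; apply: contraT => xy.
  by have /forallP/(_ y)/implyP/(_ xy) := sep x; rewrite Nxy eqxx.
- exact: subsetIr.
- exact: dom.
Qed.

(** * The prism and its two layers *)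

Lemma nbr_box (G : sgraph) n (u v : box G (complete_graph n)) :
  nbr u v = if u.2 == v.2 then nbr u.1 v.1 else u.1 == v.1.
Proof.
case: u v => [x i] [y j]; rewrite /nbr /= /box_rel /= xpair_eqE /complete_rel.
by rewrite [y == x]eq_sym [j == i]eq_sym; case: (i == j); case: (x == y).
Qed.

Notation prism G := (box G (complete_graph 2)).

Definition layer (G : sgraph) (C : {set prism G}) (i : 'I_2)
  : {set G} := [set x : G | (x, i) \in C].

Lemma card_layers (G : sgraph) (C : {set prism G}) :
  #|C| = #|layer C ord0| + #|layer C ord_max|.
Proof.
have layerE i : #|layer C i| = \sum_(x : G) ((x, i) \in C).
  by rewrite -sum1dep_card big_mkcond.
rewrite !layerE -sum1_card big_mkcond /=.
rewrite (eq_bigr (fun u : G * 'I_2 => nat_of_bool ((u.1, u.2) \in C))); last first.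
  by case=> x i _ /=; case: ifP.
rewrite -(pair_big predT predT (fun x i => nat_of_bool ((x, i) \in C))) /=.
have -> : ord_max = lift ord0 ord0 :> 'I_2 by apply/val_inj.
by rewrite exchange_big big_ord_recl big_ord1.
Qed.

(* A vertex (x, i) with x outside the other layer is only seen from its own
   layer, whose trace on N[x] must therefore identify x. *)
Lemma card_outside_layer (G : sgraph) (C : {set prism G})
    (i j : 'I_2) :
  id_code C -> i != j -> #|~: layer C j| < 2 ^ #|layer C i|.
Proof.
move=> /id_codeP[dom sep] ij.
have other (k : 'I_2) : k != i -> k = j.
  by move: i j k ij => [[|[|//]] ?] [[|[|//]] ?] [[|[|//]] ?] // _ _; apply/val_inj.
have nbr_layer x (u : prism G) :
    x \in ~: layer C j -> u \in C -> u.2 != i -> nbr ((x, i) : prism G) u = false.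
  case: u => w k; rewrite !inE => xC wC /= /other kj; rewrite nbr_box /= kj (negPf ij).
  by apply: contraNF xC => /eqP ->; rewrite -kj.
apply: (@card_lt_exp2 _ _ _ _ (fun x => closed_nbhd x :&: layer C i)).
- move=> x y xj yj Nxy; apply/eqP; apply: contraT => xy.
  have /sep[[w k] wC] : (x, i) != (y, i) :> prism G by rewrite xpair_eqE eqxx andbT.
  have [ki|ki] := eqVneq k i; last by rewrite !nbr_layer.
  move/setP/(_ w): Nxy; rewrite !inE -!/(nbr _ _) -ki wC !andbT.
  by rewrite !nbr_box /= eqxx => ->; rewrite eqxx.
- by move=> x _; apply: subsetIr.
- move=> x xj; have [[w k] wC] := dom (x, i).
  have [ki|ki] := eqVneq k i; last by rewrite nbr_layer.
  rewrite ki nbr_box /= eqxx => xw; apply/set0Pn; exists w.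
  by rewrite !inE -!/(nbr _ _) xw -ki.
Qed.

Lemma card_box_code4 (G : sgraph) (C : {set prism G}) :
  id_code C -> #|C| = 4 -> #|G| <= 5.
Proof.
move=> codeC; rewrite card_layers.
have := @card_outside_layer _ _ ord0 ord_max codeC isT.
have := @card_outside_layer _ _ ord_max ord0 codeC isT.
have := cardsC (layer C ord0); have := cardsC (layer C ord_max).
(* Small sizes turn the powers of two into numerals. The split 2 + 2 gives the bound 5; the splits 1
   + 3 and 0 + 4 give 4. *)
move: #|layer C ord0| #|layer C ord_max| => [|[|[|[|[|a]]]]] [|[|[|[|[|b]]]]] //=; lia.
Qed.

(** * Codes and isomorphisms read off lists of vertices *)

(* Only [e] is inspected, never equality of vertices, so that the test can be
   transported along any listing of the vertices by numbers and then computed. *)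
Definition identifies (T : Type) (e : rel T) (s c : seq T) : bool :=
  all (fun x => has (e x) c) s
  && pairwise (fun x y => has (fun z => e x z != e y z) c) s.

Definition adj_mx (T : Type) (e : rel T) (s : seq T) : seq (seq bool) :=
  [seq [seq e x y | y <- s] | x <- s].

Lemma identifies_map (T U : Type) (h : T -> U) (e : rel U) (s c : seq T) :
  identifies e (map h s) (map h c) = identifies (relpre h e) s c.
Proof.
rewrite /identifies all_map pairwise_map; congr andb.
  by apply: eq_all => x /=; rewrite has_map.
by apply: eq_pairwise => x y /=; rewrite has_map.
Qed.

Lemma eq_in_identifies (T : eqType) (e e' : rel T) (s c : seq T) :
  {in s & c, e =2 e'} -> identifies e s c = identifies e' s c.
Proof.
move=> ee'; rewrite /identifies; congr andb.
  by apply: eq_in_all => x xs; apply: eq_in_has => y yc; apply: ee'.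
apply: (@eq_in_pairwise _ (mem s)); last exact/allP.
by move=> x y xs ys /=; apply: eq_in_has => z zc; rewrite !ee'.
Qed.

Definition listing (T : eqType) (s : seq T) : Prop := uniq s /\ forall x, x \in s.

Lemma listing_enum (T : finType) : listing (enum T).
Proof. by split=> [|x]; rewrite ?enum_uniq ?mem_enum. Qed.

Lemma listing_perm (T : eqType) (s t : seq T) :
  perm_eq s t -> listing s -> listing t.
Proof.
move=> st [us alls]; split=> [|x]; first by rewrite -(perm_uniq st).
by rewrite -(perm_mem st).
Qed.

Lemma size_listing (T : finType) (s : seq T) : listing s -> size s = #|T|.
Proof. by case=> us alls; rewrite -(card_uniqP us); apply: eq_card. Qed.

Lemma id_code_identifies (G : sgraph) (s c : seq G) :
  listing s -> id_code [set x in c] = identifies (@nbr G) s c.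
Proof.
move=> [us alls]; apply/id_codeP/andP => -[dom sep]; split.
- by apply/allP => x _; have [z] := dom x; rewrite inE => zc xz; apply/hasP; exists z.
- rewrite uniq_pairwise in us; apply: sub_pairwise us => x y /sep[z].
  by rewrite inE => zc xyz; apply/hasP; exists z.
- move=> x; have /hasP[z zc xz] := allP dom x (alls x).
  by exists z; rewrite ?inE.
(* The test compares pairs in list order only. The guard [x != y] makes [r] reflexive, and with
   symmetry this extends the test to all pairs. *)
- pose r x y := (x != y) ==> has (fun z => nbr x z != nbr y z) c.
  have rxx : reflexive r by move=> x; rewrite /r eqxx.
  have rC : symmetric r.
    move=> x y; rewrite /r eq_sym; congr (_ ==> _).
    by apply: eq_has => z; rewrite eq_sym.
  have : pairwise r s by apply: sub_pairwise sep => x y; rewrite /r => ->; rewrite implybT.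
  rewrite pairwise_all2rel // => /allrelP/= sepr x y xy.
  have /implyP/(_ xy)/hasP[z zc xyz] := sepr x y (alls x) (alls y).
  by exists z; rewrite ?inE.
Qed.

(** An isomorphism carries [t] back to a listing of [G]; conversely, vertices at equal positions of
    [s] and [t] correspond. [y0] is the default of [nth] and shows that [t] is not empty. *)
Lemma isomorphicP (G H : sgraph) (y0 : H) (t : seq H) : listing t ->
  isomorphic G H <->
  exists2 s : seq G, listing s & adj_mx (@nbr G) s = adj_mx (@nbr H) t.
Proof.
move=> lt; split=> [[f [g fK gK] fadj] | [s ls eq_mx]].
  have nbrg x y : nbr (g x) (g y) = nbr x y.
    by rewrite /nbr (can_eq gK) -fadj !gK.
  exists (map g t); first split=> [|x].
  - by rewrite (map_inj_uniq (can_inj gK)) lt.1.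
  - by rewrite -(fK x) map_f // lt.2.
  - rewrite /adj_mx -map_comp; apply: eq_map => x /=.
    by rewrite -map_comp; apply: eq_map => y /=.
have sz : size s = size t by have := congr1 size eq_mx; rewrite !size_map.
have [x0 _] : exists x0 : G, x0 \in s.
  by case: (s) sz => [|x0 ? _]; [case: (t) (lt.2 y0) | exists x0; rewrite mem_head].
have idx x : index x s < size t by rewrite -sz index_mem ls.2.
have idy y : index y t < size s by rewrite sz index_mem lt.2.
pose f x := nth y0 t (index x s); pose g y := nth x0 s (index y t).
have fK : cancel f g by move=> x; rewrite /f /g index_uniq ?nth_index ?ls.2 ?lt.1.
have gK : cancel g f by move=> y; rewrite /f /g index_uniq ?nth_index ?lt.2 ?ls.1.
exists f; first by exists g.
move=> x y; have [<-|xy] := eqVneq x y; first by rewrite !adj_irrefl.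
have nbrf : nbr (f x) (f y) = nbr x y.
  have := congr1 (fun m => nth false (nth [::] m (index x s)) (index y s)) eq_mx.
  rewrite /adj_mx (nth_map x0) ?index_mem ?ls.2 // (nth_map x0) ?index_mem ?ls.2 //.
  rewrite !nth_index ?ls.2 // => ->.
  by rewrite (nth_map y0) // (nth_map y0).
by move: nbrf; rewrite /nbr (can_eq fK) eq_sym (negPf xy).
Qed.

(** * Vertices replaced by numbers, in the graph and in its prism *)

Definition mx_rel (m : seq (seq bool)) : rel nat := fun i j => nth false (nth [::] m i) j.

Lemma mx_rel_nth (T : Type) (x0 : T) (e : rel T) (s : seq T) (i j : nat) :
  i < size s -> j < size s ->
  mx_rel (adj_mx e s) i j = e (nth x0 s i) (nth x0 s j).
Proof. by move=> lti ltj; rewrite /mx_rel (nth_map x0) // (nth_map x0). Qed.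

(* [(i, b)] stands for the copy of the [i]-th vertex in layer [b]. *)
Definition prism_rel (e : rel nat) : rel (nat * bool) := fun u v =>
  if u.2 == v.2 then e u.1 v.1 else u.1 == v.1.

Definition prism_numbers (n : nat) : seq (nat * bool) :=
  [seq (i, b) | i <- iota 0 n, b <- [:: false; true]].

Section Numbering.

Variables (G : sgraph) (x0 : G) (s : seq G) (e : rel nat).
Hypothesis listing_s : listing s.
Hypothesis eE : forall i j, i < size s -> j < size s ->
  e i j = nbr (nth x0 s i) (nth x0 s j).

(** Agreement of [e] with [nbr] is known only below [size s], hence the condition on [c]. *)
Lemma map_nth_listing c : {subset c <= iota 0 (size s)} ->
  id_code [set x in map (nth x0 s) c] = identifies e (iota 0 (size s)) c.
Proof.
move=> subc; rewrite (id_code_identifies _ listing_s).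
rewrite -[X in identifies _ X _](mkseq_nth x0 s) identifies_map.
apply: eq_in_identifies => i j; rewrite mem_iota => /= lti /subc.
by rewrite mem_iota => /= ltj; rewrite eE.
Qed.

Definition vertex_of (u : nat * bool) : prism G :=
  (nth x0 s u.1, if u.2 then ord_max else ord0).

Lemma inj_vertex_of : {in prism_numbers (size s) &, injective vertex_of}.
Proof.
move=> u v /allpairsP[[i b] [/=]] + _ -> /allpairsP[[j b'] [/=]] + _ ->.
rewrite !mem_iota /= => lti ltj [/eqP]; rewrite nth_uniq ?listing_s.1 //.
by move=> /eqP ->; case: b; case: b'.
Qed.

Lemma listing_vertex_of : listing (map vertex_of (prism_numbers (size s))).
Proof.
split.
  rewrite map_inj_in_uniq; last exact: inj_vertex_of.
  by apply: allpairs_uniq; rewrite ?iota_uniq // => u v _ _; case: u v => [? ?] [].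
case=> x i; apply/mapP; exists (index x s, i == ord_max).
  apply: allpairs_f; first by rewrite mem_iota index_mem listing_s.2.
  by case: (_ == _).
rewrite /vertex_of /= nth_index ?listing_s.2 //; congr (_, _).
by apply/val_inj; case: i => [[|[|//]] ?].
Qed.

Lemma prism_code c : {subset c <= prism_numbers (size s)} ->
  id_code [set u in map vertex_of c]
  = identifies (prism_rel e) (prism_numbers (size s)) c.
Proof.
move=> subc; rewrite (id_code_identifies _ listing_vertex_of) identifies_map.
apply: eq_in_identifies => u v us /subc vs.
have := inj_in_eq inj_vertex_of us vs.
case/allpairsP: us vs => [[i b] [/= + _ ->]]; rewrite mem_iota => /= lti.
case/allpairsP => [[j b'] [/= + _ ->]]; rewrite mem_iota => /= ltj _.
rewrite nbr_box /prism_rel /= eE // nth_uniq ?listing_s.1 //.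
by case: b; case: b'.
Qed.

End Numbering.

(** * Exhaustive search over subsets and labelled graphs *)

Fixpoint bitseqs (n : nat) : seq (seq bool) :=
  if n is n'.+1 then [seq b :: m | m <- bitseqs n', b <- [:: false; true]]
  else [:: [::]].

Lemma mem_bits m : m \in bitseqs (size m).
Proof.
elim: m => // b m IHm; apply/allpairsP; exists (m, b); split=> //.
by case: b.
Qed.

Definition sublists (T : Type) (k : nat) (s : seq T) : seq (seq T) :=
  [seq mask m s | m <- bitseqs (size s) & count id m == k].

Lemma filter_sublists (T : eqType) (P : pred T) (s : seq T) :
  filter P s \in sublists (count P s) s.
Proof.
rewrite filter_mask; apply: map_f; rewrite mem_filter count_map eqxx /=.
by rewrite -(size_map P) mem_bits.
Qed.

Lemma sublists_sub (T : eqType) k (s c : seq T) :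
  c \in sublists k s -> {subset c <= s}.
Proof. by case/mapP => m _ -> x; apply: mem_mask. Qed.

Lemma sublists_size (T : eqType) k (s c : seq T) :
  c \in sublists k s -> size c <= k.
Proof.
case/mapP => m; rewrite mem_filter => /andP[/eqP <- _] ->.
by elim: m s => [|[] m IHm] [|x s] //=; rewrite ?ltnS ?add0n.
Qed.

(* A graph on [0 .. n-1] is stored as its strict lower triangle: row [j] lists
   the adjacencies of [j] to [0 .. j-1]. *)
Fixpoint triangles (n : nat) : seq (seq (seq bool)) :=
  if n is n'.+1 then [seq rcons g r | g <- triangles n', r <- bitseqs n'] else [:: [::]].

Definition triangle_rel (g : seq (seq bool)) : rel nat := fun i j =>
  (i == j) || nth false (nth [::] g (maxn i j)) (minn i j).

Definition triangle (e : rel nat) (n : nat) : seq (seq bool) :=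
  mkseq (fun j => mkseq (e j) j) n.

Lemma mem_triangles e n : triangle e n \in triangles n.
Proof.
elim: n => [|n IHn] //; rewrite /triangle mkseqS /=.
apply: allpairs_f => //.
by have := mem_bits (mkseq (e n) n); rewrite size_mkseq.
Qed.

(** The entries below the diagonal are stored; reflexivity and symmetry of [e] restore the
    others. *)
Lemma triangleE (e : rel nat) (n i j : nat) :
  reflexive e -> symmetric e -> i < n -> j < n ->
  triangle_rel (triangle e n) i j = e i j.
Proof.
move=> exx eC; have tC : symmetric (triangle_rel (triangle e n)).
  by move=> k l; rewrite /triangle_rel eq_sym maxnC minnC.
wlog ltij : i j / i < j.
  move=> IH lti ltj; have [ij|ji|<-] := ltngtP i j; first exact: IH.
    by rewrite tC eC; apply: IH.
  by rewrite /triangle_rel eqxx exx.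
move=> _ ltj; rewrite /triangle_rel ltn_eqF // (maxn_idPr (ltnW ltij)) (minn_idPl (ltnW ltij)).
by rewrite !nth_mkseq.
Qed.

(** Computable consequences of the hypotheses on the graph: no isolated vertex, from connectedness;
    the whole vertex set is a code, from twin-freeness; no three vertices form a code, from the
    lower bound 4. *)
Definition candidate (n : nat) (e : rel nat) : bool :=
  [&& all (fun i => has (fun j => (j != i) && e i j) (iota 0 n)) (iota 0 n),
      identifies e (iota 0 n) (iota 0 n)
    & ~~ has (identifies e (iota 0 n)) (sublists 3 (iota 0 n))].

(** Closed adjacency of the path 0-1-2-3 with hub 4. *)
Definition fan_mx : seq (seq bool) :=
  [:: [:: true; true; false; false; true];
      [:: true; true; true; false; true];
      [:: false; true; true; true; true];
      [:: false; false; true; true; true];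
      [:: true; true; true; true; true]].

(** Closed adjacency of the cycle 0-2-1-3 with hub 4; the nonadjacent pairs 0, 1 and 2, 3 are the
    two copies of [A_graph 1]. *)
Definition wheel_mx : seq (seq bool) :=
  [:: [:: true; false; true; true; true];
      [:: false; true; true; true; true];
      [:: true; true; true; false; true];
      [:: true; true; false; true; true];
      [:: true; true; true; true; true]].

Definition relabels (e : rel nat) (m : seq (seq bool)) : bool :=
  has (fun p => adj_mx e p == m) (permutations (iota 0 5)).

(** The first two tests leave only P4, C4 and the star with three leaves, each of which has a code
    of three vertices. *)
Lemma no_candidate4 : all (fun g => ~~ candidate 4 (triangle_rel g)) (triangles 4).
Proof. by vm_compute. Qed.

(** There are 1024 labelled graphs; filtering them first confines the search through the 210
    four-subsets of the prism to the candidates. *)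
Lemma candidates5 :
  all (fun g =>
        has (identifies (prism_rel (triangle_rel g)) (prism_numbers 5)) (sublists 4 (prism_numbers 5))
        ==> relabels (triangle_rel g) fan_mx || relabels (triangle_rel g) wheel_mx)
      [seq g <- triangles 5 | candidate 5 (triangle_rel g)].
Proof. by vm_compute. Qed.

Lemma prism_code_exists (m : seq (seq bool)) : m \in [:: fan_mx; wheel_mx] ->
  has (identifies (prism_rel (mx_rel m)) (prism_numbers 5)) (sublists 4 (prism_numbers 5)).
Proof. by rewrite !inE => /orP[] /eqP ->; vm_compute. Qed.

(** * Vertices that every code must contain *)

(* [v] alone tells [x] and [y] apart; [forced_co] yields such a pair once a
   universal vertex is added, and the disjunction of both survives joins. *)
Definition forced_pair (G : sgraph) (v : G) : Prop :=
  exists x y : G, forall w, (nbr x w != nbr y w) = (w == v).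

Definition forced_co (G : sgraph) (v : G) : Prop :=
  exists x : G, forall w, nbr x w = (w != v).

Lemma nbr_A k (i j : A_graph k) : 0 < k -> nbr i j = (i - j + (j - i) <= k.-1).
Proof.
rewrite /nbr /= /A_rel [j == i]eq_sym; case: eqVneq => //= <-.
by rewrite subnn.
Qed.

(** In [A_graph k] closed neighborhoods are intervals: moving the center by one adds or drops one
    end, and the centers [k] and [k.-1] miss only the first and the last vertex. Both forms pass to
    a join, where each vertex sees the whole other side. *)
Lemma forced_class_A (F : sgraph) (v : F) :
  class_A F -> forced_pair v \/ forced_co v.
Proof.
move=> classF; elim: classF v => {F} [k k_gt0 [v ltv] | F1 F2 _ IH1 _ IH2 [v|v]].
- have step (a b : nat) : a < 2 * k -> b < 2 * k ->
    (forall w, w < 2 * k ->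
      ((a - w + (w - a) <= k.-1) != (b - w + (w - b) <= k.-1)) = (w == v)) ->
    forced_pair (Ordinal ltv : A_graph k).
    move=> lta ltb ab; exists (Ordinal lta), (Ordinal ltb) => -[w ltw].
    by rewrite !nbr_A //= ab.
  have [v0|v_gt0] := posnP v.
    have ltk : k < 2 * k by lia.
    right; exists (Ordinal ltk) => -[w ltw]; rewrite nbr_A //= -val_eqE /= v0.
    by apply/idP/idP; lia.
  have [vk|kv] := ltnP v k.
    (* Both intervals reach the last vertex; they start at [v] and [v.+1]. *)
    by left; apply: (step (k + v).-1 (k + v)) => [||w ltw]; [lia|lia|];
      apply/idP/idP; lia.
  have [v2k|v2k] := eqVneq v (2 * k).-1.
    have ltk : k.-1 < 2 * k by lia.
    right; exists (Ordinal ltk) => -[w ltw]; rewrite nbr_A //= -val_eqE /= v2k.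
    by apply/idP/idP; lia.
  (* Both intervals start at the first vertex; they end at [v.-1] and [v]. *)
  by left; apply: (step (v - k) (v - k).+1) => [||w ltw]; [lia|lia|];
    apply/idP/idP; lia.
- case: (IH1 v) => [[x [y xy]]|[x xv]]; [left; exists (inl x), (inl y)|right; exists (inl x)].
    by case=> w //; apply: xy.
  by case=> w //; apply: xv.
- case: (IH2 v) => [[x [y xy]]|[x xv]]; [left; exists (inr x), (inr y)|right; exists (inr x)].
    by case=> w //; apply: xy.
  by case=> w //; apply: xv.
Qed.

(** If [x] misses only [v], then [v] alone tells [x] from the universal vertex added by the join. *)
Lemma forced_join_K1 (F : sgraph) (v : F) :
  class_A F -> forced_pair (inl v : join F (complete_graph 1)).
Proof.
move=> classF; case: (forced_class_A v classF) => [[x [y xy]]|[x xv]].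
  by exists (inl x), (inl y) => -[w|w] //; apply: xy.
exists (inl x), (inr ord0) => -[w|w]; last by rewrite /nbr /= ord1 eqxx.
have -> : nbr (inl x : join F (complete_graph 1)) (inl w) = (w != v) by apply: xv.
by rewrite -[inl w == inl v]/(w == v); case: (w == v).
Qed.

Lemma card_id_code_join_K1 (F : sgraph) (D : {set join F (complete_graph 1)}) :
  class_A F -> id_code D -> #|F| <= #|D|.
Proof.
move=> classF /id_codeP[_ sep].
rewrite -(card_imset _ (@inl_inj F 'I_1)); apply/subset_leq_card/subsetP.
move=> _ /imsetP[v _ ->]; have [x [y xy]] := forced_join_K1 v classF.
have xNy : x != y by apply/eqP => xEy; move: (xy (inl v)); rewrite xEy !eqxx.
by have [z zD] := sep x y xNy; rewrite xy => /eqP <-.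
Qed.

Lemma id_code_isomorphic (G H : sgraph) (C : {set G}) :
  isomorphic G H -> id_code C -> exists2 D : {set H}, id_code D & #|D| = #|C|.
Proof.
move=> [f [g fK gK] fadj] /id_codeP[dom sep]; exists (f @: C); last first.
  by rewrite card_imset //; apply: can_inj fK.
have nbrg x y : nbr x (f y) = nbr (g x) y.
  by rewrite /nbr -{2}(gK x) fadj -{1}(gK x) (can_eq fK).
apply/id_codeP; split=> [x|x y].
  by have [z zC xz] := dom (g x); exists (f z); rewrite ?imset_f ?nbrg.
rewrite -(can_eq gK) => /sep[z zC xyz].
by exists (f z); rewrite ?imset_f ?nbrg.
Qed.

(** * Members of the class with two or four vertices *)

Lemma card_class_A (F : sgraph) : class_A F -> 0 < #|F| /\ ~~ odd #|F|.
Proof.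
elim=> {F} [k k_gt0|F1 F2 _ [F1_gt0 F1_even] _ [F2_gt0 F2_even]].
  by rewrite card_ord mul2n odd_double double_gt0.
by rewrite card_sum addn_gt0 F1_gt0 oddD (negPf F1_even).
Qed.

Lemma class_A_card2 (F : sgraph) : class_A F -> #|F| = 2 -> F = A_graph 1.
Proof.
case=> [k _|F1 F2 /card_class_A[F1_gt0 F1_even] /card_class_A[F2_gt0 F2_even]].
  by rewrite card_ord => k2; congr A_graph; lia.
by rewrite card_sum; lia.
Qed.

(** Orders in the class are even and positive, so a join of order 4 splits as 2 + 2. The class
    consists of concrete graphs, which allows equality in place of isomorphism. *)
Lemma class_A_card4 (F : sgraph) : class_A F -> #|F| = 4 ->
  F = A_graph 2 \/ F = join (A_graph 1) (A_graph 1).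
Proof.
case=> [k _|F1 F2 cF1 cF2].
  by rewrite card_ord => k4; left; congr A_graph; lia.
have [F1_gt0 F1_even] := card_class_A cF1; have [F2_gt0 F2_even] := card_class_A cF2.
rewrite card_sum => F4; have F12 : #|F1| = 2 by lia.
have F22 : #|F2| = 2 by lia.
by right; rewrite (class_A_card2 cF1 F12) (class_A_card2 cF2 F22).
Qed.

Lemma isomorphic_card (G H : sgraph) : isomorphic G H -> #|G| = #|H|.
Proof. by case=> f bij_f _; apply: bij_eq_card bij_f. Qed.

(** * The fan and the wheel up to isomorphism *)

Definition fan_graph := join (A_graph 2) (complete_graph 1).
Definition wheel_graph := join (join (A_graph 1) (A_graph 1)) (complete_graph 1).

Definition fan_listing : seq fan_graph :=
  [:: inl (@Ordinal 4 0 isT); inl (@Ordinal 4 1 isT); inl (@Ordinal 4 2 isT);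
      inl (@Ordinal 4 3 isT); inr ord0].

Definition wheel_listing : seq wheel_graph :=
  [:: inl (inl (@Ordinal 2 0 isT)); inl (inl (@Ordinal 2 1 isT));
      inl (inr (@Ordinal 2 0 isT)); inl (inr (@Ordinal 2 1 isT)); inr ord0].

Lemma listing_fan : listing fan_listing.
Proof.
by split=> // -[[[|[|[|[|//]]]] ?]|[[|//] ?]]; rewrite !inE.
Qed.

Lemma listing_wheel : listing wheel_listing.
Proof.
by split=> // -[[[[|[|//]] ?]|[[|[|//]] ?]]|[[|//] ?]]; rewrite !inE.
Qed.

Lemma isomorphic_fan (G : sgraph) : isomorphic G fan_graph <->
  exists2 s : seq G, listing s & adj_mx (@nbr G) s = fan_mx.
Proof.
have <- : adj_mx (@nbr fan_graph) fan_listing = fan_mx by vm_compute.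
exact: (@isomorphicP G fan_graph (inr ord0)) listing_fan.
Qed.

Lemma isomorphic_wheel (G : sgraph) : isomorphic G wheel_graph <->
  exists2 s : seq G, listing s & adj_mx (@nbr G) s = wheel_mx.
Proof.
have <- : adj_mx (@nbr wheel_graph) wheel_listing = wheel_mx by vm_compute.
exact: (@isomorphicP G wheel_graph (inr ord0)) listing_wheel.
Qed.

Lemma A_join_K1_card5 (G : sgraph) : #|G| = 5 -> A_join_K1 G <->
  exists s : seq G, listing s /\ adj_mx (@nbr G) s \in [:: fan_mx; wheel_mx].
Proof.
move=> cardG; split=> [[F classF isoG]|[s [ls]]].
  have F4 : #|F| = 4.
    by move: (isomorphic_card isoG); rewrite cardG card_sum card_ord; lia.
  have [FE|FE] := class_A_card4 classF F4; rewrite FE in isoG.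
    have /isomorphic_fan[s ls sE] := isoG; exists s.
    by rewrite sE mem_head.
  have /isomorphic_wheel[s ls sE] := isoG; exists s.
  by rewrite sE !inE eqxx orbT.
rewrite !inE => /orP[] /eqP sE.
  exists (A_graph 2); first exact: class_A_base.
  by apply/isomorphic_fan; exists s.
exists (join (A_graph 1) (A_graph 1)); first by apply: class_A_join; apply: class_A_base.
by apply/isomorphic_wheel; exists s.
Qed.

(** * Twin-freeness of the prism *)

Lemma connected_neighbor (G : sgraph) (x : G) :
  connected G -> 1 < #|G| -> exists y, adj x y.
Proof.
move=> [_ connG] cardG.
have [y yx] : exists y, y != x.
  have /card_gt1P[a [b [_ _ ab]]] := cardG.
  by have [<-|ax] := eqVneq a x; [exists b; rewrite eq_sym | exists a].
have /connectP[[|z p] /= path_p lastp] := connG x y; first by rewrite lastp eqxx in yx.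
by case/andP: path_p; exists z.
Qed.

(** The two copies of a vertex are told apart by a neighbor within one layer, two vertices of one
    layer by the copy of either in the other layer, and the remaining pairs by one of their own
    members. *)
Lemma prism_twin_free (G : sgraph) :
  twin_free G -> (forall x : G, exists y, adj x y) -> twin_free (prism G).
Proof.
move=> tfG nbG; apply: (@id_code_twin_free _ setT); apply/id_codeP.
split=> [u|[x i] [y j]]; first by exists u; rewrite // /nbr eqxx.
have [k ik] : exists k, k != i.
  by case: i => [[|[|//]] ?]; [exists ord_max | exists ord0].
rewrite xpair_eqE negb_and; have [<-|xy _] := eqVneq x y.
  rewrite /= => ij; have [w xw] := nbG x; exists (w, i); first by rewrite inE.
  have xNw : (x == w) = false by apply: contraTF xw => /eqP ->; rewrite adj_irrefl.
  by rewrite !nbr_box /= eqxx [j == i]eq_sym (negPf ij) /nbr xw orbT xNw.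
have [<-|ij] := eqVneq i j.
  by exists (x, k); rewrite ?inE // !nbr_box /= [i == k]eq_sym (negPf ik) eqxx [y == x]eq_sym (negPf xy).
by exists (x, i); rewrite ?inE // !nbr_box /= eqxx [j == i]eq_sym (negPf ij) [y == x]eq_sym
  (negPf xy) /nbr eqxx.
Qed.

(** * From a prism code of size 4 to the fan or the wheel *)

Section CandidateGraph.

Variables (G : sgraph) (x0 : G).
Hypotheses (connG : connected G) (tfG : twin_free G).
Hypothesis gamma_ge4 : forall C : {set G}, id_code C -> 4 <= #|C|.

(** Thanks to the default [x0], [e] is reflexive and symmetric on all numbers, as [triangleE]
    requires. *)
Let e : rel nat := relpre (nth x0 (enum G)) (@nbr G).

Lemma candidate_gamma4 : 1 < #|G| ->
  candidate #|G| (triangle_rel (triangle e #|G|)).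
Proof.
move=> cardG; have lG := listing_enum G; have sG := size_listing lG.
have eE i j : i < size (enum G) -> j < size (enum G) ->
    triangle_rel (triangle e #|G|) i j = nbr (nth x0 (enum G) i) (nth x0 (enum G) j).
  rewrite sG => lti ltj; apply: triangleE => // [k|k l]; last exact: nbr_sym.
  by rewrite /e /= /nbr eqxx.
rewrite /candidate; apply/and3P; split.
- apply/allP => i; rewrite mem_iota /= => lti.
  have [y xy] := connected_neighbor (nth x0 (enum G) i) connG cardG.
  have lty : index y (enum G) < #|G| by rewrite -sG index_mem lG.2.
  apply/hasP; exists (index y (enum G)); first by rewrite mem_iota.
  rewrite eE ?sG // nth_index ?lG.2 // /nbr xy orbT andbT.
  by apply: contraTneq xy => <-; rewrite nth_index ?lG.2 // adj_irrefl.
- rewrite -{2}sG -(map_nth_listing lG eE) ?sG //.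
  have -> : [set x in map (nth x0 (enum G)) (iota 0 #|G|)] = setT.
    by apply/setP => x; rewrite -sG -/(mkseq _ _) mkseq_nth !inE lG.2.
  exact: id_code_setT.
- apply/hasPn => c c_sub; rewrite -{2}sG -(map_nth_listing lG eE).
    apply/negP => /gamma_ge4; rewrite leqNgt ltnS => /negP; apply.
    rewrite cardsE; apply: leq_trans (card_size _) _.
    by rewrite size_map (sublists_size c_sub).
  by rewrite sG; apply: sublists_sub c_sub.
Qed.

Lemma prism_code_relabels (C : {set prism G}) :
  1 < #|G| -> id_code C -> #|C| = 4 ->
  #|G| = 5 /\ exists s : seq G,
    listing s /\ adj_mx (@nbr G) s \in [:: fan_mx; wheel_mx].
Proof.
move=> cardG codeC cardC; have cand := candidate_gamma4 cardG.
have lG := listing_enum G; have sG := size_listing lG.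
have G_le5 := card_box_code4 codeC cardC.
have G_ge4 : 4 <= #|G|.
  by rewrite -cardsT; apply/gamma_ge4/id_code_setT.
have [G4|G5] : #|G| = 4 \/ #|G| = 5 by lia.
  move: cand; rewrite G4 => cand.
  by have /negP := allP no_candidate4 _ (mem_triangles e 4).
split=> //; rewrite G5 in sG cand *.
have eE i j : i < 5 -> j < 5 -> triangle_rel (triangle e 5) i j = e i j.
  by apply: triangleE => [k|k l]; [rewrite /e /= /nbr eqxx | exact: nbr_sym].
have : relabels (triangle_rel (triangle e 5)) fan_mx
    || relabels (triangle_rel (triangle e 5)) wheel_mx.
  apply: (implyP (allP candidates5 (triangle e 5) _)).
    by rewrite mem_filter cand mem_triangles.
  have inj5 : {in prism_numbers 5 &, injective (vertex_of x0 (enum G))}.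
    by rewrite -sG; apply: inj_vertex_of lG.
  have l5 : listing (map (vertex_of x0 (enum G)) (prism_numbers 5)).
    by rewrite -sG; apply: listing_vertex_of lG.
  (* Listed in the order of the numbers, the code becomes one of the enumerated sublists. *)
  pose inC u := vertex_of x0 (enum G) u \in C.
  have CE : C = [set u in map (vertex_of x0 (enum G)) (filter inC (prism_numbers 5))].
    apply/setP => u; rewrite inE; apply/idP/mapP => [uC|[k + ->]].
      have /mapP[k k5 uk] := l5.2 u.
      by exists k; rewrite // mem_filter k5 andbT /inC -uk.
    by rewrite mem_filter => /andP[].
  apply/hasP; exists (filter inC (prism_numbers 5)).
    rewrite -[X in sublists X _]cardC [in X in sublists X]CE cardsE.
    rewrite (card_uniqP _) ?size_map ?size_filter ?filter_sublists //.
    rewrite map_inj_in_uniq ?filter_uniq // => u v.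
    by rewrite !mem_filter => /andP[_ u5] /andP[_ v5]; apply: inj5.
  move: codeC; rewrite {1}CE -[in X in identifies _ X]sG.
  rewrite (prism_code lG (e := triangle_rel (triangle e 5))) ?sG //.
  by move=> u; rewrite mem_filter => /andP[].
(* In both cases, reading the vertices in the order of the permutation [p] gives the required
   listing. *)
rewrite /relabels => /orP[] /hasP[p]; rewrite mem_permutations => p_perm /eqP pE.
all: exists (map (nth x0 (enum G)) p); split.
all: try by apply: listing_perm lG;
  rewrite -[X in perm_eq X](mkseq_nth x0 (enum G)) sG perm_map // perm_sym.
all: suff -> : adj_mx (@nbr G) (map (nth x0 (enum G)) p)
    = adj_mx (triangle_rel (triangle e 5)) p by rewrite pE !inE eqxx ?orbT.
all: rewrite /adj_mx -map_comp; apply/eq_in_map => i /=.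
all: rewrite (perm_mem p_perm) mem_iota => /= lti; rewrite -map_comp.
all: apply/eq_in_map => j; rewrite (perm_mem p_perm) mem_iota => /= ltj.
all: by rewrite eE.
Qed.

End CandidateGraph.

(** * Codes in the prisms of the fan and the wheel, and the equivalence *)

Lemma prism_code_fan_wheel (G : sgraph) (s : seq G) :
  listing s -> adj_mx (@nbr G) s \in [:: fan_mx; wheel_mx] ->
  exists2 C : {set prism G}, id_code C & #|C| <= 4.
Proof.
move=> ls mxs; have s5 : size s = 5.
  have <- : size (adj_mx (@nbr G) s) = size s by rewrite size_map.
  by move: mxs; rewrite !inE => /orP[] /eqP ->.
have [x0 _] : exists x0, x0 \in s.
  by case: (s) s5 => [|x0 ?] // _; exists x0; rewrite mem_head.
have /hasP[c c_sub] := prism_code_exists mxs; rewrite -s5 => code_c.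
exists [set u in map (vertex_of x0 s) c].
  rewrite (prism_code ls (e := mx_rel (adj_mx (@nbr G) s))) // => [i j lti ltj|].
    exact: mx_rel_nth.
  by rewrite s5; apply: sublists_sub c_sub.
rewrite cardsE; apply: leq_trans (card_size _) _.
by rewrite size_map (sublists_size c_sub).
Qed.

Theorem theorem13 (G : sgraph) (connG : connected G) (tfG : twin_free G)
    (gammaG : gammaID G = 4) :
  gammaID (box G (complete_graph 2)) = gammaID G <-> A_join_K1 G.
Proof.
have [[C codeC cardC] minG] := (gammaIDP 4 tfG).1 gammaG.
have G_ge4 : 4 <= #|G| by rewrite -cardsT; apply/minG/id_code_setT.
have G_gt1 : 1 < #|G| by apply: leq_trans G_ge4.
have [x0 _] : exists x0 : G, x0 \in G by apply/card_gt0P; apply: leq_trans G_ge4.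
have tfprism : twin_free (prism G).
  by apply: prism_twin_free => // x; apply: connected_neighbor.
rewrite gammaG (gammaIDP 4 tfprism); split=> [[[D codeD cardD] _]|AG].
  have [G5 mxG] := prism_code_relabels x0 connG tfG minG G_gt1 codeD cardD.
  exact/A_join_K1_card5.
(* The code of size 4, carried over to the join, bounds [#|F|] by 4; as [#|F|] is even and at least
   3, it equals 4. *)
have G5 : #|G| = 5.
  have [F classF isoG] := AG.
  have [D codeD cardD] := id_code_isomorphic isoG codeC.
  have := card_id_code_join_K1 classF codeD; rewrite cardD cardC.
  have [_] := card_class_A classF.
  by move: G_ge4; rewrite (isomorphic_card isoG) card_sum card_ord; lia.
(* The prism has ten vertices, while three codewords have only seven nonempty traces. *)
have minP (D : {set prism G}) : id_code D -> 4 <= #|D|.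
  move=> /id_code_card_lt; rewrite card_prod card_ord G5.
  by case: #|D| => [|[|[|[|]]]].
split=> //; have /A_join_K1_card5-/(_ G5)[s [ls mxs]] := AG.
have [D codeD D_le4] := prism_code_fan_wheel ls mxs.
by exists D => //; apply/eqP; rewrite eqn_leq D_le4 minP.
Qed.
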